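(* Let $p$ be a prime congruent to $4$ or $7$ modulo $9$. If $p$ satisfies condition (I), then neither $up$ nor $up^{2}$ is of the form $x^{3}+y^{3}$ with $x$ and $y$ in $\mathcal{K}$. (In particular, for all primes $p\le 73$ with $p\equiv 4$ or $7 \pmod 9$, neither $up$ nor $up^{2}$ admits such a representation.)
   Context: Let $u$ and $v$ be the two roots in $\mathbb{C}$ of $z^{2}+z+1=0$ (so $u,v$ are the primitive cube roots of unity). $\mathcal{O}$ is the set of $\mathbb{Z}$-linear combinations of $1,u,v$ (the ring of Eisenstein integers) and $\mathcal{K}$ is the set of $\mathbb{Q}$-linear combinations of $1,u,v$ (its field of fractions). A prime $p\equiv 1\pmod 3$ can be written as $p=\pi\bar\pi$ with $\pi\in\mathcal{O}$ irreducible, $\pi\equiv 1\pmod{3}$ in $\mathcal{O}$, and $\pi,\bar\pi$ not associates. Condition (I) for such $p$: $\bar{\pi}$ is a cube in the multiplicative group of the field $\mathcal{O}/\pi$. *)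

(* Defs.v *)
From mathcomp Require Export all_boot all_order all_algebra.
From mathcomp Require Export reals.
From mathcomp Require Export complex.

Set Implicit Arguments.
Unset Strict Implicit.
Unset Printing Implicit Defensive.

Import Order.TTheory GRing.Theory Num.Theory.
Local Open Scope ring_scope.

(* Throughout, u and v stand for the two roots of z^2 + z + 1 in C. *)

Definition eisO (C : numClosedFieldType) (u v z : C) : Prop :=
  exists a b c : int, z = a%:~R + b%:~R * u + c%:~R * v.

Definition eisK (C : numClosedFieldType) (u v z : C) : Prop :=
  exists a b c : rat, z = ratr a + ratr b * u + ratr c * v.

Definition eis_unit (C : numClosedFieldType) (u v x : C) : Prop :=
  eisO u v x /\ exists2 y : C, eisO u v y & x * y = 1.

Definition eis_irreducible (C : numClosedFieldType) (u v x : C) : Prop :=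
  [/\ eisO u v x, ~ eis_unit u v x
    & forall a b : C, eisO u v a -> eisO u v b -> x = a * b ->
        eis_unit u v a \/ eis_unit u v b].

Definition eis_assoc (C : numClosedFieldType) (u v x y : C) : Prop :=
  exists2 e : C, eis_unit u v e & x = e * y.

(* For a, b in O, this is equality of the classes of a and b in O / m O. *)
Definition eis_congr (C : numClosedFieldType) (u v m a b : C) : Prop :=
  exists2 c : C, eisO u v c & a - b = m * c.

(* x represents an element of the multiplicative group of O / m O. *)
Definition eis_mod_unit (C : numClosedFieldType) (u v m x : C) : Prop :=
  eisO u v x /\ exists2 y : C, eisO u v y & eis_congr u v m (x * y) 1.

(* The class of a is a cube in the multiplicative group of O / m O. *)
Definition eis_mod_cube (C : numClosedFieldType) (u v m a : C) : Prop :=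
  eis_mod_unit u v m a /\
  exists2 x : C, eis_mod_unit u v m x & eis_congr u v m a (x ^+ 3).

Definition primary_split (C : numClosedFieldType) (u v : C) (p : nat) (w : C)
    : Prop :=
  [/\ p%:R = w * Num.conj w, eis_irreducible u v w, eis_congr u v 3%:R w 1
    & ~ eis_assoc u v w (Num.conj w)].

(* The factor w is determined by p up to complex conjugation, and conjugation
   exchanges the conditions for w and for its conjugate, so it does not matter
   which factor is chosen. *)
Definition conditionI (C : numClosedFieldType) (u v : C) (p : nat) : Prop :=
  exists2 w : C, primary_split u v p w & eis_mod_cube u v w (Num.conj w).

Definition sum_two_cubes (C : numClosedFieldType) (u v z : C) : Prop :=
  exists x y : C, [/\ eisK u v x, eisK u v y & z = x ^+ 3 + y ^+ 3].

(* Main.v *)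
Require Import Defs.
From mathcomp Require Import all_boot all_order all_algebra.
From mathcomp Require Import reals complex.
From HB Require Import structures.
From mathcomp Require Import finfield boolp.
From mathcomp Require Import zify ring.
Import Order.TTheory GRing.Theory Num.Theory.
Local Open Scope ring_scope.
Local Open Scope complex_scope.

Set Implicit Arguments.
Unset Strict Implicit.
Unset Printing Implicit Defensive.

(** Infinite descent on triples [m1 + m2 + m3 = 0] of pairwise coprime Eisenstein
    integers with product [A Z^3], where [A = u p^k], [p = w w'] and [w'] is the
    conjugate of [w].  Unique factorization gives [mi = ai zi^3] with
    [a1 a2 a3 = A].  If [w] and [w'] divide different [ai], then reducing the
    relation modulo [w] and modulo [w'], where by condition (I) the other factor
    is a cube, shows that the unit parts of the [ai] agree up to sign, because [u]
    is not a cube modulo [w] when [p] is 4 or 7 mod 9; so their product [u] is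
    plus or minus a cube, which is absurd.  If [w] and [w'] divide the same [ai],
    the same argument turns the relation into [X^3 + Y^3 = A W^3] with [W]
    dividing [Z].  Modulo 3 this forces [1 - u] to divide [W], and the factors
    [X + Y], [u (X + u Y)], [u^2 (X + u^2 Y)] divided by [1 - u] form a new triple
    of the same kind, with [W / (1 - u)] in place of [Z].  Condition (I) is used in
    the form: the trace of [w] is a cube modulo [p]. *)

(** * The ring of Eisenstein integers and its norm *)

(* [Eis a b] stands for [a + b u], where [u ^+ 2 = - u - 1]. *)
Record eis := Eis {ere : int; eim : int}.

Definition pair_of_eis (x : eis) := (ere x, eim x).
Definition eis_of_pair (x : int * int) := Eis x.1 x.2.
Lemma pair_of_eisK : cancel pair_of_eis eis_of_pair. Proof. by case. Qed.

HB.instance Definition _ := Choice.copy eis (can_type pair_of_eisK).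

Definition eadd x y := Eis (ere x + ere y) (eim x + eim y).
Definition eopp x := Eis (- ere x) (- eim x).
Definition emul x y := Eis (ere x * ere y - eim x * eim y)
  (ere x * eim y + eim x * ere y - eim x * eim y).

Lemma eaddA : associative eadd.
Proof. by move=> [a b] [c d] [e f]; congr Eis; rewrite /= addrA. Qed.

Lemma eaddC : commutative eadd.
Proof. by move=> [a b] [c d]; congr Eis; rewrite /= addrC. Qed.

Lemma eadd0 : left_id (Eis 0 0) eadd.
Proof. by move=> [a b]; congr Eis; rewrite /= add0r. Qed.

Lemma eaddN : left_inverse (Eis 0 0) eopp eadd.
Proof. by move=> [a b]; congr Eis; rewrite /= addNr. Qed.

HB.instance Definition _ := GRing.isZmodule.Build eis eaddA eaddC eadd0 eaddN.

Lemma emulA : associative emul.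
Proof. by move=> [a b] [c d] [e f]; congr Eis => /=; ring. Qed.

Lemma emulC : commutative emul.
Proof. by move=> [a b] [c d]; congr Eis => /=; ring. Qed.

Lemma emul1 : left_id (Eis 1 0) emul.
Proof. by move=> [a b]; congr Eis => /=; ring. Qed.

Lemma emulD : left_distributive emul eadd.
Proof. by move=> [a b] [c d] [e f]; congr Eis => /=; ring. Qed.

Lemma eis1_neq0 : Eis 1 0 != 0.
Proof. by []. Qed.

HB.instance Definition _ :=
  GRing.Zmodule_isComNzRing.Build eis emulA emulC emul1 emulD eis1_neq0.

Definition enorm (x : eis) : int :=
  ere x ^+ 2 - ere x * eim x + eim x ^+ 2.
Definition econj (x : eis) : eis := Eis (ere x - eim x) (- eim x).
Definition om : eis := Eis 0 1.
Definition eint (n : int) : eis := Eis n 0.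

Lemma eintE (n : int) : eint n = n%:~R.
Proof.
have natE (m : nat) : m%:R = eint m.
  by elim: m => [//|m IH]; rewrite -natr1 IH; congr Eis => /=; lia.
by case: n => m; rewrite ?NegzE ?mulrNz -pmulrn natE.
Qed.

Lemma enormM x y : enorm (x * y) = enorm x * enorm y.
Proof. by case: x => a b; case: y => c d; rewrite /enorm /=; ring. Qed.

(** Completing the square: this makes the norm nonnegative and bounds the coordinates of units. *)
Lemma enorm4 x : 4 * enorm x = (2 * ere x - eim x) ^+ 2 + 3 * eim x ^+ 2.
Proof. by rewrite /enorm; ring. Qed.

Lemma enorm_ge0 x : 0 <= enorm x.
Proof.
have := enorm4 x; have := sqr_ge0 (2 * ere x - eim x); have := sqr_ge0 (eim x).
lia.
Qed.

Lemma enorm_eq0 x : (enorm x == 0) = (x == 0).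
Proof.
apply/eqP/eqP => [h|-> //]; have := enorm4 x; rewrite h mulr0.
have := sqr_ge0 (2 * ere x - eim x); have := sqr_ge0 (eim x) => h1 h2 h3.
have /eqP : eim x ^+ 2 = 0 by lia.
have /eqP : (2 * ere x - eim x) ^+ 2 = 0 by lia.
rewrite !sqrf_eq0 => /eqP ha /eqP hb.
by case: x {h h1 h2 h3} ha hb => a b /= ha hb; congr Eis; lia.
Qed.

Lemma mul_econj x : x * econj x = eint (enorm x).
Proof. by case: x => a b; congr Eis; rewrite /enorm /=; ring. Qed.

Lemma add_econj x : x + econj x = (2 * ere x - eim x)%:~R.
Proof. by rewrite -eintE; congr Eis => /=; ring. Qed.

Definition eunit : pred eis := fun x => enorm x == 1.
(** An element of norm 1 has its conjugate as inverse; elsewhere the value is [x] itself, the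
    convention for non-units. *)
Definition einv x := if eunit x then econj x else x.

Lemma emulV : {in eunit, left_inverse 1 einv *%R}.
Proof.
move=> x ux; have {}ux : enorm x = 1 by exact/eqP.
by rewrite /einv /eunit ux eqxx mulrC mul_econj ux.
Qed.

Lemma eunitPl x y : y * x = 1 -> eunit x.
Proof.
move=> /(congr1 enorm); rewrite enormM => h; rewrite /eunit.
have : (enorm x %| 1)%Z by apply/dvdzP; exists (enorm y).
by rewrite dvdz1; have := enorm_ge0 x; lia.
Qed.

Lemma einv_out : {in [predC eunit], einv =1 id}.
Proof. by move=> x /negbTE nux; rewrite /einv ifF. Qed.

HB.instance Definition _ :=
  GRing.ComNzRing_hasMulInverse.Build eis emulV eunitPl einv_out.

Lemma eis_integral : GRing.integral_domain_axiom eis.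
Proof.
move=> x y /eqP; rewrite -enorm_eq0 enormM mulf_eq0.
by rewrite !enorm_eq0.
Qed.

HB.instance Definition _ := GRing.ComUnitRing_isIntegral.Build eis eis_integral.

Lemma eunitE (x : eis) : (x \is a GRing.unit) = (enorm x == 1).
Proof. by []. Qed.

(** * Divisibility, primes and coprimality in an integral domain *)

Definition divides (R : idomainType) (d x : R) : Prop := exists k, x = k * d.

Definition prime_elt (R : idomainType) (q : R) : Prop :=
  [/\ q != 0, q \isn't a GRing.unit
    & forall x y, divides q (x * y) -> divides q x \/ divides q y].

(** Phrased through common primes because the descent tests coprimality at one prime at a time. *)
Definition coprime_elt (R : idomainType) (x y : R) : Prop :=
  forall q, prime_elt q -> divides q x -> divides q y -> False.

Lemma divides_mull (R : idomainType) (d x y : R) :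
  divides d y -> divides d (x * y).
Proof. by move=> [k ->]; exists (x * k); rewrite mulrA. Qed.

Lemma divides_mulr (R : idomainType) (d x y : R) :
  divides d x -> divides d (x * y).
Proof. by rewrite mulrC; apply: divides_mull. Qed.

Lemma divides_add (R : idomainType) (d x y : R) :
  divides d x -> divides d y -> divides d (x + y).
Proof. by move=> [k ->] [l ->]; exists (k + l); rewrite mulrDl. Qed.

Lemma divides_unit (R : idomainType) (q u : R) :
  prime_elt q -> u \is a GRing.unit -> ~ divides q u.
Proof.
by move=> [_ + _] + [k uE]; rewrite uE unitrM => /negbTE ->; rewrite andbF.
Qed.

Lemma prime_divides_exp (R : idomainType) (q x : R) n :
  prime_elt q -> divides q (x ^+ n) -> divides q x.
Proof.
move=> pq; elim: n => [|n IH]; first by move/(divides_unit pq (unitr1 _)).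
by rewrite exprS; case: pq => _ _ /[apply] -[].
Qed.

Lemma divides_exp_cancel (R : idomainType) (q x y : R) n :
  prime_elt q -> ~ divides q y -> divides (q ^+ n) (x * y) ->
  divides (q ^+ n) x.
Proof.
move=> pq nqy; have [q0 _ qP] := pq.
elim: n x => [|n IH] x; first by move=> _; exists x; rewrite expr0 mulr1.
move=> [k kE]; have [|[x' xE]|//] := qP x y.
  by exists (k * q ^+ n); rewrite kE exprSr mulrA.
have [|m mE] := IH x'.
  by exists k; apply: (mulIf q0); rewrite mulrAC -xE kE exprSr mulrA.
by exists m; rewrite xE mE exprSr mulrA.
Qed.

Lemma coprime_elt_sym (R : idomainType) (x y : R) :
  coprime_elt x y -> coprime_elt y x.
Proof. by move=> h q pq qx qy; apply: (h q). Qed.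

Lemma coprime_elt_dvd (R : idomainType) (x y x' y' : R) :
  divides x' x -> divides y' y -> coprime_elt x y -> coprime_elt x' y'.
Proof.
by move=> [k ->] [l ->] h q pq qx qy; apply: (h q pq); apply: divides_mull.
Qed.

(** * Euclidean division and existence of prime divisors *)

Lemma int_round (c n : int) : 0 < n -> exists q, `|2 * (c - q * n)| <= n.
Proof.
move=> n0; exists ((2 * c + n) %/ (2 * n))%Z.
have := divz_eq (2 * c + n) (2 * n).
have := modz_ge0 (2 * c + n) (_ : 2 * n != 0).
have := ltz_pmod (2 * c + n) (_ : 0 < 2 * n).
set q := (_ %/ _)%Z; set r := (_ %% _)%Z => h1 h2 h3.
have {}h1 : r < 2 * n by apply: h1; lia.
have {}h2 : 0 <= r by apply: h2; lia.
by nia.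
Qed.

(** Both coordinates of [x / y] are rounded; the error has coordinates at most 1/2 in absolute
    value, hence norm at most 3/4. *)
Lemma eis_euclid (x y : eis) : y != 0 ->
  exists q r, x = q * y + r /\ enorm r < enorm y.
Proof.
rewrite -enorm_eq0 => y0; have ny : 0 < enorm y by rewrite lt0r y0 enorm_ge0.
have [q1 hq1] := int_round (ere (x * econj y)) ny.
have [q2 hq2] := int_round (eim (x * econj y)) ny.
exists (Eis q1 q2), (x - Eis q1 q2 * y); split; first by rewrite addrC subrK.
have nyc : enorm (econj y) = enorm y by rewrite /enorm /=; ring.
(* Multiplying by [enorm (econj y)], which equals [enorm y], replaces the quotient [x / y] by the
   integral element [x * econj y]. *)
rewrite -(ltr_pM2r ny) -{1}nyc -enormM mulrBl -mulrA mul_econj.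
move: hq1 hq2; set z := x * econj y.
have -> : enorm (z - Eis q1 q2 * eint (enorm y)) =
    (ere z - q1 * enorm y) ^+ 2 - (ere z - q1 * enorm y) * (eim z - q2 * enorm y)
    + (eim z - q2 * enorm y) ^+ 2.
  by rewrite {1}/enorm /=; ring.
by move: (ere z - _) (eim z - _) => s t hs ht; nia.
Qed.

Lemma eis_gcd (x y : eis) :
  exists g s t, [/\ g = s * x + t * y, divides g x & divides g y].
Proof.
have [n] := ubnP `|enorm y|%N; elim: n x y => // n IH x y yn.
have [->|y0] := eqVneq y 0.
  exists x, 1, 0; rewrite mul1r mul0r addr0; split=> //; first by exists 1; rewrite mul1r.
  by exists 0; rewrite mul0r.
have [q [r [xE rn]]] := eis_euclid x y0.
have [|g [s [t [gE gy gr]]]] := IH y r.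
  by have := enorm_ge0 r; lia.
exists g, t, (s - t * q); split=> //; first by rewrite gE xE; ring.
by rewrite xE; apply: divides_add => //; apply: divides_mull.
Qed.

(** Proper factors have smaller norm, so induction reduces to an irreducible [z], which is prime by
    the Bezout relation of [eis_gcd]. *)
Lemma eis_prime_divisor (z : eis) : z != 0 -> z \isn't a GRing.unit ->
  exists2 q, prime_elt q & divides q z.
Proof.
have [n] := ubnP `|enorm z|%N; elim: n z => // n IH z zn z0 zu.
have [[x [y [zE xu yu]]]|irr] := EM (exists x y,
  [/\ z = x * y, x \isn't a GRing.unit & y \isn't a GRing.unit]).
  move: z0; rewrite zE mulf_eq0 => /norP[x0 y0].
  have [|q pq qx] := IH x _ x0 xu.
    move: zn y0 x0 yu; rewrite zE enormM -!enorm_eq0 eunitE.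
    have := enorm_ge0 x; have := enorm_ge0 y; nia.
  by exists q => //; apply: divides_mulr.
exists z; last by exists 1; rewrite mul1r.
split=> // x y zxy; have [g [s [t [gE [k kE] gx]]]] := eis_gcd z x.
have [gu|gu] := boolP (g \is a GRing.unit).
  right; have -> : y = g^-1 * (s * z + t * x) * y by rewrite -gE mulVr ?mul1r.
  rewrite mulrDr mulrDl; apply: divides_add.
    by exists (g^-1 * s * y); ring.
  by rewrite !mulrA -(mulrA _ x); apply: divides_mull.
have ku : k \is a GRing.unit.
  by apply/negPn/negP => ku; apply: irr; exists k, g.
left; case: gx => l ->; exists (l * k^-1).
by rewrite kE mulrA mulrVK.
Qed.

(** * Coprime factors of a constant times a cube *)

Definition cube_split (A Z l1 l2 l3 : eis) : Prop :=
  exists a1 a2 a3 z1 z2 z3,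
  [/\ l1 = a1 * z1 ^+ 3, l2 = a2 * z2 ^+ 3, l3 = a3 * z3 ^+ 3,
      a1 * a2 * a3 = A & z1 * z2 * z3 = Z].

(** By coprimality a prime [q] of [Z] divides only one [li], so [q ^+ 3] divides that one and can be
    divided out; induction on the norm of [Z]. The products come out as exactly [A] and [Z], with no
    stray unit. *)
Lemma coprime_cube_split (A Z l1 l2 l3 : eis) : Z != 0 ->
  coprime_elt l1 l2 -> coprime_elt l1 l3 -> coprime_elt l2 l3 ->
  l1 * l2 * l3 = A * Z ^+ 3 -> cube_split A Z l1 l2 l3.
Proof.
have [n] := ubnP `|enorm Z|%N; elim: n Z l1 l2 l3 => // n IH Z l1 l2 l3 Zn Z0.
have [Zu|Zu] := boolP (Z \is a GRing.unit).
  move=> _ _ _ lE; exists l1, l2, (l3 * Z^-1 ^+ 3), 1, 1, Z.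
  split; rewrite ?expr1n ?mulr1 ?mul1r //.
    by rewrite -mulrA -exprMn mulVr // expr1n mulr1.
  by rewrite mulrA lE -mulrA -exprMn mulrV // expr1n mulr1.
have [q pq [Z' ZE]] := eis_prime_divisor Z0 Zu.
have [q0 qu qP] := pq.
have Z'0 : Z' != 0 by move: Z0; rewrite ZE mulf_eq0 => /norP[].
have Z'n : (`|enorm Z'| < n)%N.
  move: Zn qu q0 Z'0; rewrite ZE enormM -!enorm_eq0 eunitE.
  have := enorm_ge0 q; have := enorm_ge0 Z'; nia.
have step m1 m2 m3 : coprime_elt m1 m2 -> coprime_elt m1 m3 ->
    coprime_elt m2 m3 -> m1 * m2 * m3 = A * Z ^+ 3 -> divides q m1 ->
    cube_split A Z m1 m2 m3.
  move=> c12 c13 c23 mE qm1.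
  have [m1' m1E] : divides (q ^+ 3) m1.
    apply: (@divides_exp_cancel _ _ _ (m2 * m3) 3 pq).
      by case/qP; [apply: c12 qm1 | apply: c13 qm1].
    by exists (A * Z' ^+ 3); rewrite mulrA mE ZE; ring.
  have dm : divides m1' m1 by exists (q ^+ 3); rewrite mulrC.
  have dr (m : eis) : divides m m by exists 1; rewrite mul1r.
  have [|a1 [a2 [a3 [z1 [z2 [z3 [h1 h2 h3 ha hz]]]]]]] :=
    IH Z' m1' m2 m3 Z'n Z'0 (coprime_elt_dvd dm (dr _) c12)
      (coprime_elt_dvd dm (dr _) c13) c23.
    apply: (mulIf (expf_neq0 3 q0)); move: mE; rewrite m1E ZE => mE.
    by transitivity (m1' * q ^+ 3 * m2 * m3); [ring | rewrite mE; ring].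
  exists a1, a2, a3, (z1 * q), z2, z3; split=> //.
    by rewrite m1E h1; ring.
  by rewrite ZE -hz; ring.
move=> c12 c13 c23 lE.
have : divides q (l1 * l2 * l3) by exists (A * Z' ^+ 3 * q ^+ 2); rewrite lE ZE; ring.
move=> /qP[/qP[]|]; first exact: step.
  move=> ql2; have [|a1 [a2 [a3 [z1 [z2 [z3 [h1 h2 h3 ha hz]]]]]]] :=
    step _ _ _ (coprime_elt_sym c12) c23 c13 _ ql2; first by rewrite -lE; ring.
  by exists a2, a1, a3, z2, z1, z3; split=> //; rewrite -?ha -?hz; ring.
move=> ql3; have [|a1 [a2 [a3 [z1 [z2 [z3 [h1 h2 h3 ha hz]]]]]]] :=
  step _ _ _ (coprime_elt_sym c13) (coprime_elt_sym c23) c12 _ ql3.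
  by rewrite -lE; ring.
by exists a2, a3, a1, z2, z3, z1; split=> //; rewrite -?ha -?hz; ring.
Qed.

(** * Ring morphisms out of the Eisenstein integers and reduction modulo [w] *)

(** The universal property of Z[t]/(t^2 + t + 1); it serves both for reduction to ['F_p] and for the
    embedding into C. *)
Lemma eis_hom (F : comNzRingType) (t : F) : t ^+ 2 + t + 1 = 0 ->
  exists f : {rmorphism eis -> F}, forall x, f x = (ere x)%:~R + (eim x)%:~R * t.
Proof.
move=> t0; pose f x : F := (ere x)%:~R + (eim x)%:~R * t.
have fB : zmod_morphism f.
  by move=> x y; rewrite /f /= !rmorphB /=; ring.
have fM : monoid_morphism f.
  split=> [|x y]; first by rewrite /f /= mul0r addr0.
  have tt : t ^+ 2 = - t - 1 by rewrite -[LHS]subr0 -t0; ring.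
  rewrite /f /= !(rmorphB, rmorphD, rmorphM) /=.
  transitivity ((ere x)%:~R * (ere y)%:~R +
    ((ere x)%:~R * (eim y)%:~R + (eim x)%:~R * (ere y)%:~R) * t +
    (eim x)%:~R * (eim y)%:~R * t ^+ 2); last by ring.
  by rewrite tt; ring.
pose fa := GRing.isZmodMorphism.Build _ _ f fB.
pose fm := GRing.isMonoidMorphism.Build _ _ f fM.
by exists (HB.pack f fa fm : {rmorphism eis -> F}).
Qed.

Lemma eis_reduction (p : nat) (w : eis) : prime p -> enorm w = p ->
  exists f : {rmorphism eis -> 'F_p}, forall x, f x = 0 <-> divides w x.
Proof.
move=> pp wN; have pF := pchar_Fp pp.
have wN' : (ere w)%:~R ^+ 2 - (ere w)%:~R * (eim w)%:~R + (eim w)%:~R ^+ 2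
    = 0 :> 'F_p.
  have : (enorm w)%:~R = 0 :> 'F_p by rewrite wN; apply: pchar_Fp_0.
  by rewrite /enorm !(rmorphB, rmorphD, rmorphM, rmorphXn).
(* If [p] divided [eim w], it would divide [ere w] too, and then [p ^ 2] would divide the norm
   [p]. *)
have pb : ~~ (p %| eim w)%Z.
  apply/negP => pb; have b0 : (eim w)%:~R = 0 :> 'F_p.
    by apply/eqP; rewrite -(dvdz_pcharf pF).
  move: wN'; rewrite b0 mulr0 subr0 expr0n addr0 => /eqP; rewrite sqrf_eq0.
  rewrite -(dvdz_pcharf pF) => /dvdzP[k kE].
  move: pb => /dvdzP[l lE]; move: wN; rewrite /enorm kE lE => wN.
  have p1 : (k ^+ 2 - k * l + l ^+ 2) * p = 1.
    apply: (@mulIf _ (p : int)); first by have := prime_gt0 pp; lia.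
    by rewrite mul1r -[RHS]wN; ring.
  have : (p %| 1)%Z by apply/dvdzP; exists (k ^+ 2 - k * l + l ^+ 2).
  by rewrite dvdz1; have := prime_gt1 pp; lia.
have b0 : (eim w)%:~R != 0 :> 'F_p by rewrite -(dvdz_pcharf pF).
(* For [w] to map to 0, [om] must go to [- ere w / eim w]. *)
have [|f fE] := @eis_hom 'F_p (- ((ere w)%:~R / (eim w)%:~R)).
  apply: (mulIf (expf_neq0 2 b0)); rewrite mul0r -[RHS]wN'; field.
  exact: b0.
have fw : f w = 0 by rewrite fE mulrN mulrCA divff // mulr1 subrr.
exists f => x; split=> [fx|[k ->]]; last by rewrite rmorphM /= fw mulr0.
have f1 : f om * (eim w)%:~R = - (ere w)%:~R.
  by rewrite fE /= add0r mul1r mulNr divfK.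
have xw : (p %| eim w * ere x - eim x * ere w)%Z.
  rewrite (dvdz_pcharf pF) rmorphB !rmorphM /=; apply/eqP.
  move: fx; rewrite fE => fx.
  transitivity ((eim w)%:~R * ((ere x)%:~R
    + (eim x)%:~R * - ((ere w)%:~R / (eim w)%:~R)) : 'F_p).
    by field; exact: b0.
  by rewrite fx mulr0.
have [m mE] := dvdzP xw.
(* Bezout recovers [x] from [eim w] times [x] and [p] times [x], both of which are multiples of
   [w]. *)
have /coprimezP[[c d] /= cd] : coprimez (eim w) p.
  by rewrite coprimez_sym coprimezE /= prime_coprime.
have pE : eint p = w * econj w by rewrite mul_econj wN.
have bx : eint (eim w) * x = eint (eim x) * w + eint m * eint p.
  congr Eis => /=; first by move: mE; lia.
  by lia.
have -> : x = eint c * (eint (eim w) * x) + eint d * eint p * x.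
  have -> : eint c * (eint (eim w) * x) + eint d * eint p * x =
    (eint c * eint (eim w) + eint d * eint p) * x by ring.
  have -> : eint c * eint (eim w) + eint d * eint p = 1.
    by congr Eis => /=; lia.
  by rewrite mul1r.
rewrite bx pE; exists (eint c * (eint (eim x) + eint m * econj w) + eint d * econj w * x).
by ring.
Qed.

(** * Units and cubes modulo [p] *)

Lemma om_root : om ^+ 2 + om + 1 = 0. Proof. by []. Qed.

Lemma om3 : om ^+ 3 = 1. Proof. by []. Qed.

Lemma om_unit : om \is a GRing.unit. Proof. by []. Qed.

(** Here [p - 1 = 3 n] with [n] prime to 3. If [f om] were a cube, its [n]-th power would be 1 by
    Fermat; its cube is 1 as well, so [f om = 1] and 3 vanishes modulo [p]. *)
Lemma om_not_cube (p : nat) (f : {rmorphism eis -> 'F_p}) (s : 'F_p) :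
  prime p -> (p = 4 %[mod 9])%N \/ (p = 7 %[mod 9])%N -> f om <> s ^+ 3.
Proof.
move=> pp p47 fs.
have f3 : f om ^+ 3 = 1 by rewrite -rmorphXn om3 rmorph1.
have s0 : s != 0.
  apply/eqP => s0; move: f3; rewrite fs s0 !expr0n /= => /esym/eqP.
  by rewrite oner_eq0.
have sp : s ^+ p.-1 = 1.
  apply: (mulfI s0); rewrite -exprS prednK ?prime_gt0 // mulr1.
  by have := expf_card s; rewrite card_Fp.
have [n pn] : exists n, (p.-1 = 3 * n)%N by exists (p.-1 %/ 3)%N; lia.
have fn : f om ^+ n = 1 by rewrite fs -exprM -pn.
have f1 : f om = 1.
  have [[m nE]|[m nE]] : (exists m, n = 3 * m + 1)%N \/ (exists m, n = 3 * m + 2)%N.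
    have : (n %% 3 = 1 \/ n %% 3 = 2)%N by lia.
    by case=> h; [left|right]; exists (n %/ 3)%N; lia.
  - by move: fn; rewrite nE exprD exprM f3 expr1n mul1r.
  - move: fn; rewrite nE exprD exprM f3 expr1n mul1r => f2.
    by rewrite -f3 exprS f2 mulr1.
have : f (om ^+ 2 + om + 1) = 0 by rewrite om_root rmorph0.
rewrite !rmorphD rmorphXn rmorph1 /= f1 expr1n => h.
have : (3%:R : 'F_p) == 0 by rewrite -h; apply/eqP; ring.
rewrite -(dvdn_pcharf (pchar_Fp pp)) => /dvdn_leq h3.
by have := h3 isT; have := prime_gt1 pp; lia.
Qed.

(** The six units are grouped so that [om] is written in terms of any unit other than 1 and -1: if
    such a unit were a cube modulo [w], so would [om] be. *)
Lemma eis_unitP (e : eis) : e \is a GRing.unit ->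
  (e = 1 \/ e = -1) \/ (om = e \/ om = - e \/ om = e ^+ 2).
Proof.
rewrite eunitE => /eqP N1; have := enorm4 e; rewrite N1.
case: e N1 => a b; rewrite /enorm /= => N1 h.
have hb : b = -1 \/ b = 0 \/ b = 1 by nia.
have ha : a = -1 \/ a = 0 \/ a = 1 by nia.
move: N1; case: ha => [->|[->|->]]; case: hb => [->|[->|->]] // _;
  by [left; left | left; right | right; left | right; right; left
     | right; right; right].
Qed.

Lemma unit_cube (p : nat) (f : {rmorphism eis -> 'F_p}) (e : eis) (s : 'F_p) :
  prime p -> (p = 4 %[mod 9])%N \/ (p = 7 %[mod 9])%N ->
  e \is a GRing.unit -> f e = s ^+ 3 -> e = 1 \/ e = -1.
Proof.
move=> pp p47 /eis_unitP[//|omE] fe; exfalso.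
have omC x := @om_not_cube p f x pp p47.
case: omE => [oE|[oE|oE]].
- by apply: (omC s); rewrite oE.
- by apply: (omC (- s)); rewrite oE rmorphN /= fe; ring.
- by apply: (omC (s ^+ 2)); rewrite oE rmorphXn /= fe; ring.
Qed.

Lemma unit_ratio (p : nat) (f : {rmorphism eis -> 'F_p}) (e e' : eis)
    (x y : 'F_p) :
  prime p -> (p = 4 %[mod 9])%N \/ (p = 7 %[mod 9])%N ->
  e \is a GRing.unit -> e' \is a GRing.unit ->
  x != 0 -> f e * x ^+ 3 = f e' * y ^+ 3 -> e = e' \/ e = - e'.
Proof.
move=> pp p47 eu e'u x0 h.
have [||ee|ee] := @unit_cube p f (e / e') (y / x) pp p47.
- by rewrite unitrM eu unitrV.
- apply: (mulIf (expf_neq0 3 x0)); rewrite -exprMn divfK // rmorphM rmorphV //.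
  by rewrite mulrAC h mulrAC divrr ?mul1r ?rmorph_unit.
- by left; rewrite -[e](divrK e'u) ee mul1r.
- by right; rewrite -[e](divrK e'u) ee mulN1r.
Qed.

(** * Factors satisfying condition (I) and the local argument at [w] *)

(* By [add_econj], the last condition says that the trace of [w] is a nonzero cube
   modulo [p]: this is condition (I), since [econj w] is congruent to the trace
   modulo [w]. *)
Definition good_factor (p : nat) (w : eis) : Prop :=
  [/\ prime p, (p = 4 %[mod 9])%N \/ (p = 7 %[mod 9])%N, enorm w = p
    & exists2 s : 'F_p, s != 0 & (2 * ere w - eim w)%:~R = s ^+ 3].

Lemma econjK : involutive econj.
Proof. by case=> a b; congr Eis => /=; ring. Qed.

Lemma good_conj p w : good_factor p w -> good_factor p (econj w).
Proof.
case=> pp p47 wN [s s0 sE]; split=> //; first by rewrite -wN /enorm /=; ring.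
by exists s => //; rewrite -sE /=; congr _%:~R; ring.
Qed.

Lemma good_reduction p w : good_factor p w ->
  exists2 f : {rmorphism eis -> 'F_p}, (forall x, f x = 0 <-> divides w x)
    & exists2 s : 'F_p, s != 0 & f (econj w) = s ^+ 3.
Proof.
case=> pp p47 wN [s s0 sE]; have [f fw] := eis_reduction pp wN.
exists f => //; exists s => //.
have fw0 : f w = 0 by apply/fw; exists 1; rewrite mul1r.
rewrite -[LHS]add0r -fw0 -rmorphD -sE.
by rewrite add_econj rmorph_int.
Qed.

(** The multiples of [w] form the kernel of a morphism to a field, which is a prime ideal. *)
Lemma good_prime p w : good_factor p w -> prime_elt w.
Proof.
move=> gw; have [f fw _] := good_reduction gw; case: gw => pp _ wN _.
have p1 := prime_gt1 pp; split.
- by rewrite -enorm_eq0 wN; lia.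
- by rewrite eunitE wN; lia.
- move=> x y /fw/eqP; rewrite rmorphM mulf_eq0.
  by case/orP=> /eqP/fw; [left | right].
Qed.

Lemma good_not_dvd_conj p w : good_factor p w -> ~ divides w (econj w).
Proof.
move=> gw; have [f fw [s s0 sE]] := good_reduction gw.
by move/fw/eqP; rewrite sE expf_eq0 (negbTE s0) andbF.
Qed.

(** Modulo [w] the first term vanishes and [econj w] is a cube, so [e3 / e2] is a cube and
    [unit_cube] applies. The exponent [k] is positive when [w] and [econj w] lie in different terms,
    and 0 when they share one. *)
Lemma local_units p w k m1 e2 e3 z2 z3 : good_factor p w -> divides w m1 ->
  coprime_elt (econj w ^+ k * e2 * z2 ^+ 3) (e3 * z3 ^+ 3) ->
  e2 \is a GRing.unit -> e3 \is a GRing.unit ->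
  m1 + econj w ^+ k * e2 * z2 ^+ 3 + e3 * z3 ^+ 3 = 0 -> e3 = e2 \/ e3 = - e2.
Proof.
move=> gw wm1 c23 e2u e3u sum0; have [f fw [s s0 sE]] := good_reduction gw.
have pw := good_prime gw; case: gw => pp p47 _ _.
move: sum0 => /(congr1 f); rewrite rmorph0 !rmorphD /= (proj2 (fw m1) wm1) add0r.
move=> fE.
(* Otherwise [w] would divide both remaining terms, against their coprimality. *)
have z30 : f z3 != 0.
  apply/eqP => z30; have m30 : f (e3 * z3 ^+ 3) = 0.
    by rewrite rmorphM rmorphXn /= z30 expr0n mulr0.
  apply: (c23 w pw); last exact/fw.
  by apply/fw; rewrite -[LHS]addr0 -[X in _ + X]m30.
apply: (@unit_ratio p f e3 e2 (f z3) (- (s ^+ k * f z2))) => //.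
move/eqP: fE; rewrite addrC addr_eq0 !rmorphM !rmorphXn /= sE => /eqP ->.
by rewrite exprAC; ring.
Qed.

Lemma good_pN p w : good_factor p w -> p%:R = w * econj w.
Proof. by case=> _ _ wN _; rewrite mul_econj wN eintE. Qed.

Lemma good_pX p w k : good_factor p w -> (p%:R : eis) ^+ k = w ^+ k * econj w ^+ k.
Proof. by move=> gw; rewrite (good_pN gw) exprMn. Qed.

Lemma good_neq0 p w : good_factor p w -> w != 0.
Proof. by move=> /good_prime[]. Qed.

(** The cofactors satisfy [e1 * e2 * a3 = om], so they are units. Reduction modulo [w] gives
    [a3 = e2] up to sign, reduction modulo [econj w] gives [a3 = e1] up to sign; then [om] is a cube
    up to sign, which [om_not_cube] forbids. *)
Lemma no_mixed p w k a1 a2 a3 z1 z2 z3 : good_factor p w -> (0 < k)%N ->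
  a1 * a2 * a3 = om * p%:R ^+ k ->
  coprime_elt (a1 * z1 ^+ 3) (a3 * z3 ^+ 3) ->
  coprime_elt (a2 * z2 ^+ 3) (a3 * z3 ^+ 3) ->
  a1 * z1 ^+ 3 + a2 * z2 ^+ 3 + a3 * z3 ^+ 3 = 0 ->
  divides (w ^+ k) a1 -> divides (econj w ^+ k) a2 -> False.
Proof.
case: k => // k gw _ aE c13 c23 sum0 [e1 a1E] [e2 a2E].
have gw' := good_conj gw; have w0 := good_neq0 gw; have w0' := good_neq0 gw'.
have eE : e1 * e2 * a3 = om.
  apply: (mulIf (expf_neq0 k.+1 (mulf_neq0 w0 w0'))).
  by rewrite -(good_pN gw) -aE a1E a2E (good_pN gw) exprMn; ring.
have := om_unit; rewrite -eE !unitrM => /andP[/andP[e1u e2u] a3u].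
move: a1E a2E; rewrite ![_ * _ ^+ k.+1]mulrC => a1E a2E.
have h2 : a3 = e2 \/ a3 = - e2.
  apply: (@local_units p w k.+1 (a1 * z1 ^+ 3) e2 a3 z2 z3 gw) => //.
  - by exists (w ^+ k * e1 * z1 ^+ 3); rewrite a1E exprS; ring.
  - by rewrite -a2E.
  - by rewrite -a2E.
have h1 : a3 = e1 \/ a3 = - e1.
  apply: (@local_units p (econj w) k.+1 (a2 * z2 ^+ 3) e1 a3 z1 z3 gw') => //.
  - by exists (econj w ^+ k * e2 * z2 ^+ 3); rewrite a2E exprS; ring.
  - by rewrite econjK -a1E.
  - by rewrite econjK -a1E -[RHS]sum0; ring.
have [f _ _] := good_reduction gw; case: gw => pp p47 _ _.
have omC x := @om_not_cube p f x pp p47.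
have [oE|oE] : om = a3 ^+ 3 \/ om = - a3 ^+ 3.
  have e2E : e2 = a3 \/ e2 = - a3 by case: h2 => ->; rewrite ?opprK; [left|right].
  have e1E : e1 = a3 \/ e1 = - a3 by case: h1 => ->; rewrite ?opprK; [left|right].
  by rewrite -eE; case: e1E => ->; case: e2E => ->;
    [left | right | right | left]; ring.
- by apply: (omC (f a3)); rewrite oE rmorphXn.
- by apply: (omC (- f a3)); rewrite oE rmorphN rmorphXn /=; ring.
Qed.

Lemma coprime_elt_unit_cube (R : idomainType) (e e' c c' z z' : R) :
  e \is a GRing.unit -> e' \is a GRing.unit ->
  coprime_elt (c * z ^+ 3) (c' * z' ^+ 3) -> coprime_elt (e * z) (e' * z').
Proof.
move=> eu e'u h q pq; have [_ _ qP] := pq.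
have red (d d' y : R) : d \is a GRing.unit -> divides q (d * y) ->
    divides q (d' * y ^+ 3).
  move=> du /qP[/(divides_unit pq du)//|qy].
  by apply: divides_mull; rewrite exprS; apply: divides_mulr.
by move=> /(red _ c _ eu) qa /(red _ c' _ e'u); apply: h qa.
Qed.

Lemma descend_cubes p w k a1 a2 a3 z1 z2 z3 : good_factor p w -> (0 < k)%N ->
  a1 * a2 * a3 = om * p%:R ^+ k ->
  coprime_elt (a2 * z2 ^+ 3) (a3 * z3 ^+ 3) ->
  a1 * z1 ^+ 3 + a2 * z2 ^+ 3 + a3 * z3 ^+ 3 = 0 ->
  divides (w ^+ k) a1 -> divides (econj w ^+ k) a1 ->
  exists X Y, coprime_elt X Y /\ X ^+ 3 + Y ^+ 3 = om * p%:R ^+ k * (- z1) ^+ 3.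
Proof.
case: k => // k gw _ aE c23 sum0 [b a1b] wa1.
have gw' := good_conj gw; have w0 := good_neq0 gw; have w0' := good_neq0 gw'.
(* The primes [w] and [econj w] do not divide each other, so the power of [econj w] passes to the
   cofactor of [w ^+ k.+1]. *)
have [e1 bE] : divides (econj w ^+ k.+1) b.
  apply: (@divides_exp_cancel _ _ _ (w ^+ k.+1) k.+1 (good_prime gw')).
    move=> /(prime_divides_exp (good_prime gw')).
    by have := good_not_dvd_conj gw'; rewrite econjK.
  by rewrite -a1b.
have a1E : a1 = e1 * p%:R ^+ k.+1 by rewrite a1b bE (good_pX _ gw); ring.
have eE : e1 * a2 * a3 = om.
  apply: (mulIf (expf_neq0 k.+1 (mulf_neq0 w0 w0'))).
  by rewrite -(good_pN gw) -aE a1E; ring.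
have := om_unit; rewrite -eE !unitrM => /andP[/andP[e1u a2u] a3u].
have h : a3 = a2 \/ a3 = - a2.
  apply: (@local_units p w 0 (a1 * z1 ^+ 3) a2 a3 z2 z3 gw) => //.
  - by exists (b * w ^+ k * z1 ^+ 3); rewrite a1b exprS; ring.
  - by rewrite expr0 mul1r.
  - by rewrite expr0 mul1r.
(* Multiplying the relation by [a2 * a3] and using [a2 ^+ 2 = a3 ^+ 2] makes the last two terms
   cubes, while the first becomes [om * p%:R ^+ k.+1 * z1 ^+ 3]. *)
exists (a3 * z2), (a2 * z3); split.
  exact: coprime_elt_unit_cube c23.
move: sum0; rewrite a1E => sum0.
apply/eqP; rewrite -subr_eq0; apply/eqP.
have sq : a3 ^+ 2 = a2 ^+ 2 by case: h => ->; ring.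
transitivity (a2 * a3 * (e1 * p%:R ^+ k.+1 * z1 ^+ 3 + a2 * z2 ^+ 3 + a3 * z3 ^+ 3)
  + a3 * z2 ^+ 3 * (a3 ^+ 2 - a2 ^+ 2) + a2 * z3 ^+ 3 * (a2 ^+ 2 - a3 ^+ 2)).
  by ring.
by rewrite sum0 sq; ring.
Qed.

(** * The prime above 3 and the descent step *)

(** The quotient by [1 - om] is the field with three elements, where [om] becomes 1. *)
Lemma lam_dvd (x : eis) : (3 %| ere x + eim x)%Z -> divides (1 - om) x.
Proof.
move=> /dvdzP[k kE]; exists (Eis (ere x - k) (k)).
by case: x kE => a b /= kE; congr Eis => /=; lia.
Qed.

(* Modulo 3 a cube is a rational integer, whereas the right-hand side is [om]
   times a rational integer, so both sides vanish. *)
Lemma lam_dvd_cube p k X Y W : (p = 4 %[mod 9])%N \/ (p = 7 %[mod 9])%N ->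
  X ^+ 3 + Y ^+ 3 = om * p%:R ^+ k * W ^+ 3 -> divides (1 - om) W.
Proof.
move=> p47 hE; apply: lam_dvd.
have [m nE] : exists m : int, (p%:R : eis) ^+ k = eint (3 * m + 1).
  have [l pE] : exists l : int, p%:R = eint (3 * l + 1).
    exists (p %/ 3)%N%:Z; have -> : 3 * (p %/ 3)%N%:Z + 1 = p by lia.
    by rewrite eintE.
  elim: k {hE} => [|k [m IH]]; first by exists 0.
  exists (3 * l * m + l + m); rewrite exprS IH pE; congr Eis => /=; ring.
have imX (Z : eis) : eim (Z ^+ 3) = 3 * (ere Z * eim Z * (ere Z - eim Z)).
  by rewrite !exprS expr0 /=; ring.
move: hE; rewrite nE => /(congr1 eim).
have -> : eim (X ^+ 3 + Y ^+ 3) = eim (X ^+ 3) + eim (Y ^+ 3) by [].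
have -> : eim (om * eint (3 * m + 1) * W ^+ 3) =
    (3 * m + 1) * ((ere W + eim W) ^+ 3
      - 3 * (2 * ere W ^+ 2 * eim W + ere W * eim W ^+ 2)).
  by rewrite !exprS !expr0 /=; ring.
rewrite !imX => hE.
have : (3 %| (ere W + eim W) ^+ 3)%Z.
  move: (ere X * _ * _) (ere Y * _ * _) (_ ^+ 3) (2 * _ * _ + _) hE => s t c d hE.
  by apply/dvdzP; exists (s + t - m * (c - 3 * d) + d); move: hE; lia.
by rewrite !dvdzE abszX Euclid_dvdX // => /andP[].
Qed.

(** Stated for a single [Z], so that the induction hypothesis on smaller norms can be handed to
    [descent_step]. *)
Definition no_triple p k Z := forall m1 m2 m3 : eis, Z != 0 ->
  m1 + m2 + m3 = 0 -> coprime_elt m1 m2 -> coprime_elt m1 m3 ->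
  coprime_elt m2 m3 -> m1 * m2 * m3 = om * p%:R ^+ k * Z ^+ 3 -> False.

Lemma enorm_lam : enorm (1 - om) = 3. Proof. by []. Qed.

Lemma lam_prime : prime_elt (1 - om).
Proof.
split=> // x y [k] /(congr1 enorm); rewrite !enormM enorm_lam => h.
have : (3 %| enorm x * enorm y)%Z by apply/dvdzP; exists (enorm k).
(* Modulo 3 the norm is the square of the sum of the coordinates. *)
have norm_dvd z : (3 %| enorm z)%Z -> divides (1 - om) z.
  move=> /dvdzP[l lE]; apply: lam_dvd.
  have : (3 %| (ere z + eim z) ^+ 2)%Z.
    apply/dvdzP; exists (l + ere z * eim z).
    by rewrite mulrDl -lE /enorm; ring.
  by rewrite !dvdzE abszX Euclid_dvdX // => /andP[].
rewrite dvdzE abszM Euclid_dvdM // => /orP[h1|h2]; [left|right]; exact: norm_dvd.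
Qed.

Lemma descent_step p k X Y W : (p = 4 %[mod 9])%N \/ (p = 7 %[mod 9])%N ->
  W != 0 -> coprime_elt X Y -> X ^+ 3 + Y ^+ 3 = om * p%:R ^+ k * W ^+ 3 ->
  (forall Z, (`|enorm Z| < `|enorm W|)%N -> no_triple p k Z) -> False.
Proof.
move=> p47 W0 cXY hE IH; have [Z ZE] := lam_dvd_cube p47 hE.
have lam0 : 1 - om != 0 by [].
have Z0 : Z != 0 by move: W0; rewrite ZE mulf_eq0 => /norP[].
have o1 : om = 1 - (1 - om) by ring.
have o2 : om ^+ 2 = 1 - (1 - om) * (1 + om) by ring.
have lE : (X + Y) * (X + om * Y) * (X + om ^+ 2 * Y) = om * p%:R ^+ k * W ^+ 3.
  rewrite -hE.
  transitivity (X ^+ 3 + Y ^+ 3 * om ^+ 3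
    + (om ^+ 2 + om + 1) * (X ^+ 2 * Y + om * X * Y ^+ 2)).
    by ring.
  by rewrite om3 om_root; ring.
have dl : divides (1 - om) ((X + Y) * (X + om * Y) * (X + om ^+ 2 * Y)).
  by rewrite lE; apply: divides_mull; exists (Z * W ^+ 2); rewrite {1}ZE !exprS ZE; ring.
(* The three factors are congruent modulo [1 - om], so all are divisible as soon as one is. *)
have d1 : divides (1 - om) (X + Y).
  have [_ _ lP] := lam_prime.
  case: (lP _ _ dl) => [/lP[//|]|] [c cE].
    exists (c + Y); rewrite mulrDl -cE; ring.
  by exists (c + (1 + om) * Y); rewrite mulrDl -cE; ring.
have [m1 m1E] := d1.
pose m2 := om * (m1 - Y); pose m3 := om ^+ 2 * (m1 - (1 + om) * Y).
have XE : X = m1 * (1 - om) - Y by rewrite -m1E; ring.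
have qXY q : divides q m1 -> divides q Y -> divides q X /\ divides q Y.
  move=> [c1 h1] [c2 h2]; split; last by exists c2.
  by exists (c1 * (1 - om) - c2); rewrite XE h1 h2; ring.
have om2 : om ^+ 2 = - 1 - om by [].
have absurd_at q : prime_elt q -> divides q m1 -> divides q Y -> False.
  by move=> pq h1 h2; have [] := qXY q h1 h2; apply: cXY.
(* Modulo a divisor of [m2], [m1] is [Y]; modulo a divisor of [m3], it is [- om ^+ 2 * Y]. A prime
   common to two of the [mi] therefore divides a unit multiple of [Y], hence [Y] and [m1], which
   [absurd_at] excludes. *)
have m2P q : divides q m2 -> exists c, m1 = c * q + Y.
  move=> [c m2E]; exists (om ^+ 2 * c).
  have -> : m1 = om ^+ 3 * (m1 - Y) + Y by rewrite om3; ring.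
  by rewrite -[om ^+ 2 * c * q]mulrA -m2E /m2; ring.
have m3P q : divides q m3 -> exists c, m1 = c * q - om ^+ 2 * Y.
  move=> [c m3E]; exists (om * c).
  transitivity (om ^+ 3 * (m1 - (1 + om) * Y) - om ^+ 2 * Y).
    by rewrite om3 om2; ring.
  by rewrite -[om * c * q]mulrA -m3E /m3; ring.
apply: (IH Z _ m1 m2 m3) => //.
- move: Z0; rewrite ZE enormM -enorm_eq0 enorm_lam => Z0.
  by have := enorm_ge0 Z; lia.
- transitivity (m1 * (om ^+ 2 + om + 1) - om * Y * (om ^+ 2 + om + 1)).
    by rewrite /m2 /m3; ring.
  by rewrite om_root !mulr0 subr0.
- move=> q pq h1 /m2P[c cE]; apply: (absurd_at q pq h1).
  by case: h1 => d dE; exists (d - c); rewrite mulrBl -dE cE; ring.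
- move=> q pq h1 /m3P[c cE]; apply: (absurd_at q pq h1).
  case: h1 => d dE; exists (om * (c - d)).
  transitivity (om ^+ 3 * Y); first by rewrite om3 mul1r.
  by rewrite -[_ * q]mulrA mulrBl -dE cE; ring.
- move=> q pq /m2P[c cE] /m3P[d dE].
  have [e YE] : divides q Y.
    exists (om ^+ 2 * (c - d)); transitivity (om ^+ 3 * Y); first by rewrite om3 mul1r.
    have cd : (c - d) * q = om * Y.
      transitivity (- Y - om ^+ 2 * Y); last by rewrite om2; ring.
      transitivity ((m1 - Y) - (m1 + om ^+ 2 * Y)); last by ring.
      by rewrite {1}cE dE; ring.
    by rewrite -[_ * q]mulrA cd; ring.
  by apply: (absurd_at q pq); [exists (c + e); rewrite mulrDl -YE | exists e].
- apply: (mulIf (expf_neq0 3 lam0)).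
  transitivity (om ^+ 3 * ((m1 * (1 - om)) * (m1 * (1 - om) - (1 - om) * Y) *
    (m1 * (1 - om) - (1 - om) * (1 + om) * Y))).
    by rewrite /m2 /m3; ring.
  have -> : om * p%:R ^+ k * Z ^+ 3 * (1 - om) ^+ 3 = om * p%:R ^+ k * W ^+ 3.
    by rewrite ZE; ring.
  by rewrite om3 mul1r -m1E -lE; ring.
Qed.

(** * Infinite descent and absence of solutions *)

Lemma prime_exp_locate (R : idomainType) (q x y z : R) n : prime_elt q ->
  coprime_elt x y -> coprime_elt x z -> coprime_elt y z ->
  divides (q ^+ n) (x * y * z) ->
  [\/ divides (q ^+ n) x, divides (q ^+ n) y | divides (q ^+ n) z].
Proof.
move=> pq cxy cxz cyz; case: n => [|n] h.
  by apply: Or31; exists x; rewrite mulr1.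
have [_ _ qP] := pq.
have [/qP[qx|qy]|qz] : divides q (x * y) \/ divides q z.
- by apply: qP; case: h => c ->; rewrite exprSr mulrA; exists (c * q ^+ n).
- apply: Or31; apply: (@divides_exp_cancel _ _ _ (y * z) _ pq); last by rewrite mulrA.
  by case/qP; [apply: cxy qx | apply: cxz qx].
- apply: Or32; apply: (@divides_exp_cancel _ _ _ (x * z) _ pq).
    by case/qP => [qx|]; [apply: cxy qx qy | apply: cyz qy].
  by have -> : y * (x * z) = x * y * z by ring.
- apply: Or33; apply: (@divides_exp_cancel _ _ _ (x * y) _ pq).
    by case/qP => [qx|qy]; [apply: cxz qx qz | apply: cyz qy qz].
  by rewrite mulrC.
Qed.

Lemma no_tripleP p w k Z : good_factor p w -> (0 < k)%N -> no_triple p k Z.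
Proof.
move=> gw k0; have [n] := ubnP `|enorm Z|%N; elim: n Z => // n IH Z Zn.
move=> m1 m2 m3 Z0 sum0 c12 c13 c23 mE.
have gw' := good_conj gw.
have [a1 [a2 [a3 [z1 [z2 [z3 [m1E m2E m3E aE zE]]]]]]] :=
  coprime_cube_split Z0 c12 c13 c23 mE.
rewrite {}m1E {}m2E {}m3E in sum0 c12 c13 c23 {mE}.
have loc (q x1 x2 x3 t1 t2 t3 : eis) : prime_elt q ->
    coprime_elt (x1 * t1 ^+ 3) (x2 * t2 ^+ 3) ->
    coprime_elt (x1 * t1 ^+ 3) (x3 * t3 ^+ 3) ->
    coprime_elt (x2 * t2 ^+ 3) (x3 * t3 ^+ 3) ->
    divides (q ^+ k) (x1 * x2 * x3) ->
    [\/ divides (q ^+ k) x1, divides (q ^+ k) x2 | divides (q ^+ k) x3].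
  have dl (x t : eis) : divides x (x * t ^+ 3) by exists (t ^+ 3); rewrite mulrC.
  move=> pq h12 h13 h23.
  have d12 : coprime_elt x1 x2 by apply: coprime_elt_dvd h12; apply: dl.
  have d13 : coprime_elt x1 x3 by apply: coprime_elt_dvd h13; apply: dl.
  have d23 : coprime_elt x2 x3 by apply: coprime_elt_dvd h23; apply: dl.
  by apply: prime_exp_locate.
have wA : divides (w ^+ k) (om * p%:R ^+ k).
  by exists (om * econj w ^+ k); rewrite (good_pX _ gw); ring.
have wA' : divides (econj w ^+ k) (om * p%:R ^+ k).
  by exists (om * w ^+ k); rewrite (good_pX _ gw); ring.
(* By symmetry the power of [w] may be taken in the first coefficient; the position of the power of
   [econj w] then decides between descent and [no_mixed]. *)
have H (b1 b2 b3 t1 t2 t3 : eis) : b1 * b2 * b3 = om * p%:R ^+ k ->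
    t1 * t2 * t3 = Z -> b1 * t1 ^+ 3 + b2 * t2 ^+ 3 + b3 * t3 ^+ 3 = 0 ->
    coprime_elt (b1 * t1 ^+ 3) (b2 * t2 ^+ 3) ->
    coprime_elt (b1 * t1 ^+ 3) (b3 * t3 ^+ 3) ->
    coprime_elt (b2 * t2 ^+ 3) (b3 * t3 ^+ 3) ->
    divides (w ^+ k) b1 -> False.
  move=> bE tE s0 h12 h13 h23 wb1.
  have [] := loc (econj w) _ _ _ _ _ _ (good_prime gw') h12 h13 h23.
  - by rewrite bE.
  - move=> wb1'; have [X [Y [cXY XYE]]] := descend_cubes gw k0 bE h23 s0 wb1 wb1'.
    have p47 : (p = 4 %[mod 9])%N \/ (p = 7 %[mod 9])%N by case: gw.
    move: Z0; rewrite -tE !mulf_eq0 => /norP[/norP[t10 t20] t30].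
    apply: (descent_step p47 _ cXY XYE); first by rewrite oppr_eq0.
    move=> Z' Z'n; apply: IH; move: Zn Z'n t20 t30; rewrite -tE !enormM -!enorm_eq0.
    have -> : enorm (- t1) = enorm t1 by rewrite /enorm /=; ring.
    rewrite !abszM => abc t'1 b0 c0; rewrite -ltnS.
    apply: leq_trans abc; rewrite ltnS; apply: leq_trans t'1 _.
    (* The norm of [t1] is at most that of [Z = t1 * t2 * t3], the other factors being nonzero. *)
    by rewrite -mulnA leq_pmulr // muln_gt0 !absz_gt0 b0.
  - exact: (no_mixed gw k0 bE h13 h23 s0 wb1).
  - move=> wb3; apply: (no_mixed (a2 := b3) (a3 := b2) gw k0 _ h12 _ _ wb1 wb3).
    + by rewrite -bE; ring.
    + exact: coprime_elt_sym h23.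
    + by rewrite -[RHS]s0; ring.
have [] := loc w _ _ _ _ _ _ (good_prime gw) c12 c13 c23; first by rewrite aE.
- exact: H aE zE sum0 c12 c13 c23.
- apply: (H a2 a1 a3 z2 z1 z3 _ _ _ (coprime_elt_sym c12) c23 c13).
  + by rewrite -aE; ring.
  + by rewrite -zE; ring.
  + by rewrite -[RHS]sum0; ring.
- apply: (H a3 a1 a2 z3 z1 z2 _ _ _ (coprime_elt_sym c13) (coprime_elt_sym c23) c12).
  + by rewrite -aE; ring.
  + by rewrite -zE; ring.
  + by rewrite -[RHS]sum0; ring.
Qed.

(** A prime [q] dividing the right side is an associate of [w] or [econj w], each of which occurs
    there only [k < 3] times. This lets common factors of [X] and [Y] be removed in
    [no_solution]. *)
Lemma prime_cube_not_dvd p w k q : good_factor p w -> (k < 3)%N ->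
  prime_elt q -> ~ divides (q ^+ 3) (om * p%:R ^+ k).
Proof.
move=> gw k3 pq qd.
wlog qw : w gw / divides q w => [H|].
  have [_ _ qP] := pq; have q_dvd : divides q (om * (w ^+ k * econj w ^+ k)).
    by case: qd => c; rewrite (good_pX _ gw) => ->; exists (c * q ^+ 2); ring.
  case: (qP _ _ q_dvd) => [/(divides_unit pq om_unit)//|/qP[]] /(prime_divides_exp pq).
    exact: H gw.
  exact: H (good_conj gw).
have [c wE] := qw; have [q0 qu _] := pq; have pw := good_prime gw.
have [w0 wu wP] := pw.
have [e qE] : divides w q.
  have /wP[[d cE]|//] : divides w (c * q) by exists 1; rewrite mul1r.
  case/negP: qu; apply/unitrPr; exists d; apply: (mulfI w0).
  by rewrite mulr1 {2}wE cE; ring.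
have : divides (w ^+ 3) (w ^+ k * (om * econj w ^+ k)).
  case: qd => d dE; exists (d * e ^+ 3); rewrite qE (good_pX _ gw) in dE *.
  by rewrite mulrCA dE; ring.
move=> /(divides_exp_cancel pw) [|d dE].
  move=> /wP[/(divides_unit pw om_unit)//|/(prime_divides_exp pw)].
  exact: (good_not_dvd_conj gw).
case/negP: wu; apply/unitrPr; exists (d * w ^+ (2 - k)).
apply: (mulfI (expf_neq0 k w0)); rewrite mulr1 {2}dE.
rewrite (_ : 3 = k + (1 + (2 - k)))%N ?exprD ?expr1; last by lia.
by ring.
Qed.

(** A prime common to [X] and [Y] must divide [Z], since its cube does not divide [om * p%:R ^+ k];
    dividing it out lowers the norm of [Z]. In the coprime case one descent step yields a forbidden
    triple. *)
Lemma no_solution p w k X Y Z : good_factor p w -> (0 < k < 3)%N -> Z != 0 ->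
  X ^+ 3 + Y ^+ 3 <> om * p%:R ^+ k * Z ^+ 3.
Proof.
move=> gw /andP[k0 k3].
have [n] := ubnP `|enorm Z|%N; elim: n X Y Z => // n IH X Y Z Zn Z0 XYE.
have [cXY|] := EM (coprime_elt X Y).
  have p47 : (p = 4 %[mod 9])%N \/ (p = 7 %[mod 9])%N by case: gw.
  by apply: (descent_step p47 Z0 cXY XYE) => Z2 _; exact: (@no_tripleP p w k Z2 gw k0).
apply=> q pq [X' XE] [Y' YE]; have [q0 qu _] := pq.
have [[Z' ZE]|nqZ] := EM (divides q Z); last first.
  apply: (prime_cube_not_dvd gw k3 pq).
  apply: (@divides_exp_cancel _ q _ (Z ^+ 3) 3 pq).
    by move/(prime_divides_exp pq).
  by exists (X' ^+ 3 + Y' ^+ 3); rewrite -XYE XE YE; ring.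
have Z'0 : Z' != 0 by move: Z0; rewrite ZE mulf_eq0 => /norP[].
apply: (IH X' Y' Z') => //.
  move: Zn qu q0 Z'0; rewrite ZE enormM -!enorm_eq0 eunitE.
  have := enorm_ge0 q; have := enorm_ge0 Z'; nia.
apply: (mulIf (expf_neq0 3 q0)).
transitivity (X ^+ 3 + Y ^+ 3); first by rewrite XE YE; ring.
by rewrite XYE ZE; ring.
Qed.

(** * Explicit factors for the primes up to 73 *)

Lemma good_factor_int (p : nat) (a b s : int) : prime p ->
  (p = 4 %[mod 9])%N \/ (p = 7 %[mod 9])%N -> enorm (Eis a b) = p ->
  ~~ (p %| s)%Z -> (p %| 2 * a - b - s ^+ 3)%Z -> good_factor p (Eis a b).
Proof.
move=> pp p47 wN ps psE; split=> //; exists s%:~R.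
  by rewrite -(dvdz_pcharf (pchar_Fp pp)).
apply/eqP; rewrite -subr_eq0 -rmorphXn -rmorphB /=.
by rewrite -(dvdz_pcharf (pchar_Fp pp)).
Qed.

Lemma good_factor_small (p : nat) : prime p -> (p <= 73)%N ->
  (p = 4 %[mod 9])%N \/ (p = 7 %[mod 9])%N -> exists w, good_factor p w.
Proof.
move=> pp p73 p47.
have : p \in [seq i <- iota 0 74 | prime i && ((i %% 9 == 4) || (i %% 9 == 7))%N].
  by rewrite mem_filter pp mem_iota /= ltnS p73 andbT; case: p47 => ->.
rewrite (_ : [seq i <- _ | _] = [:: 7; 13; 31; 43; 61; 67])%N; last by vm_compute.
rewrite !inE => /or4P[/eqP pE|/eqP pE|/eqP pE|/or3P[/eqP pE|/eqP pE|/eqP pE]];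
  subst p.
(* Each witness is an element of norm [p] congruent to 1 modulo 3, followed by a cube root of its
   trace modulo [p]. *)
- by exists (Eis 1 3); apply: (@good_factor_int _ 1 3 3).
- by exists (Eis 4 3); apply: (@good_factor_int _ 4 3 7).
- by exists (Eis 1 6); apply: (@good_factor_int _ 1 6 3).
- by exists (Eis 1 (-6)); apply: (@good_factor_int _ 1 (-6) 2).
- by exists (Eis 4 9); apply: (@good_factor_int _ 4 9 14).
- by exists (Eis 7 9); apply: (@good_factor_int _ 7 9 32).
Qed.

(** * Transfer to the complex numbers *)

Lemma root_sum (C : numClosedFieldType) (u v : C) : u ^+ 2 + u + 1 = 0 ->
  v ^+ 2 + v + 1 = 0 -> u <> v -> v = - 1 - u.
Proof.
move=> hu hv huv; have : (u - v) * (u + v + 1) = 0.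
  by transitivity ((u ^+ 2 + u + 1) - (v ^+ 2 + v + 1)); [ring | rewrite hu hv subrr].
move/eqP; rewrite mulf_eq0 subr_eq0 => /orP[/eqP//|/eqP h].
by apply/eqP; rewrite -subr_eq0; apply/eqP; rewrite -[RHS]h; ring.
Qed.

(** The conjugate is again a root. Were it not the other one, [u] would be real, and the square of
    [2 * u + 1] would be -3. *)
Lemma conj_root (C : numClosedFieldType) (u : C) : u ^+ 2 + u + 1 = 0 ->
  Num.conj u = - 1 - u.
Proof.
move=> hu; have [//|uu] := eqVneq (Num.conj u) (- 1 - u).
have hc : Num.conj u ^+ 2 + Num.conj u + 1 = 0.
  by rewrite -rmorphXn -(rmorph1 Num.conj) -!rmorphD hu rmorph0.
have uc : Num.conj u = u.
  have [//|/eqP uc] := eqVneq (Num.conj u) u.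
  by have := root_sum hc hu uc => uE; case/eqP: uu; rewrite [in RHS]uE; ring.
have := mul_conjC_ge0 (2 * u + 1).
rewrite rmorphD rmorphM rmorph1 rmorph_nat /= uc.
have -> : (2 * u + 1) * (2 * u + 1) = 4 * (u ^+ 2 + u + 1) - 3 :> C by ring.
by rewrite hu mulr0 sub0r oppr_ge0 lern0.
Qed.

(** If [f] kills an element it kills its norm, an integer, and C has characteristic 0. *)
Lemma eis_hom_inj (C : numClosedFieldType) (f : {rmorphism eis -> C}) : injective f.
Proof.
move=> x y /eqP; rewrite -subr_eq0 -rmorphB => /eqP fxy.
apply/eqP; rewrite -subr_eq0 -enorm_eq0 -(intr_eq0 C).
have := mul_econj (x - y); rewrite eintE => /(congr1 f).
by rewrite rmorphM fxy mul0r rmorph_int => <-.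
Qed.

Lemma sum_two_cubes_eis (C : numClosedFieldType) (u v z : C) (f : {rmorphism eis -> C}) :
  (forall x, f x = (ere x)%:~R + (eim x)%:~R * u) -> v = - 1 - u ->
  sum_two_cubes u v z ->
  exists X Y n, n != 0 /\ f X ^+ 3 + f Y ^+ 3 = z * n%:~R ^+ 3.
Proof.
move=> fE vE; have den x : eisK u v x -> exists X (n : int), n != 0 /\ f X = x * n%:~R.
  move=> [a [b [c ->]]]; pose a' := a - c; pose b' := b - c.
  exists (Eis (numq a' * denq b') (numq b' * denq a')), (denq a' * denq b').
  split; first by rewrite mulf_neq0 ?denq_neq0.
  have -> : ratr a + ratr b * u + ratr c * v = ratr a' + ratr b' * u.
    by rewrite vE !rmorphB; ring.
  rewrite fE /= !rmorphM /= /ratr; field.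
  by rewrite !intr_eq0 !denq_neq0.
move=> [x [y [/den[X [n [n0 XE]]] /den[Y [m [m0 YE]]] ->]]].
exists (X * eint m), (Y * eint n), (n * m); split; first by rewrite mulf_neq0.
by rewrite !rmorphM /= XE YE !eintE !rmorph_int; ring.
Qed.

Lemma not_sum_two_cubes (C : numClosedFieldType) (u v : C) p w k :
  u ^+ 2 + u + 1 = 0 -> v = - 1 - u -> good_factor p w -> (0 < k < 3)%N ->
  ~ sum_two_cubes u v (u * p%:R ^+ k).
Proof.
move=> hu vE gw k03; have [f fE] := eis_hom hu.
move=> /(sum_two_cubes_eis fE vE)[X [Y [n [n0 XYE]]]].
apply: (@no_solution p w k X Y n%:~R gw k03).
  by rewrite -(inj_eq (@eis_hom_inj _ f)) rmorph_int rmorph0 intr_eq0.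
apply: (@eis_hom_inj _ f).
have fom : f om = u by rewrite fE /= add0r mul1r.
by rewrite rmorphD !rmorphM !rmorphXn /= rmorph_nat rmorph_int fom.
Qed.

(** The witnesses of condition (I) are pulled back along the embedding of [eis] into C and then
    reduced modulo [w], where [econj w] equals the trace. *)
Lemma conditionI_good (C : numClosedFieldType) (u v : C) p :
  u ^+ 2 + u + 1 = 0 -> v = - 1 - u -> prime p ->
  (p = 4 %[mod 9])%N \/ (p = 7 %[mod 9])%N ->
  conditionI u v p -> exists w, good_factor p w.
Proof.
move=> hu vE pp p47 [w0 [pE [[a [b [c w0E]]] _ _] _ _] [[_ [y yO hy]] [x [xO _] hx]]].
have [f fE] := eis_hom hu; have finj := @eis_hom_inj _ f.
have fO z : eisO u v z -> exists z', z = f z'.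
  move=> [a' [b' [c' ->]]]; exists (Eis (a' - c') (b' - c')).
  by rewrite fE vE /= !rmorphB /=; ring.
have fconj z : Num.conj (f z) = f (econj z).
  rewrite !fE !(rmorphD, rmorphM, rmorphN) /= !rmorph_int (conj_root hu); ring.
have [w wE] : exists w, w0 = f w by apply: fO; exists a, b, c.
have [y' yE] := fO _ yO; have [x' xE] := fO _ xO.
have [c1 c1O] := hy; have [c1' c1E] := fO _ c1O.
have [c2 c2O] := hx; have [c2' c2E] := fO _ c2O.
move: pE; rewrite {}wE {}yE {}xE {}c1E {}c2E fconj => pE.
move=> h2 h1.
have wN : enorm w = p.
  move: pE; rewrite -rmorphM mul_econj eintE rmorph_int.
  by rewrite -[p%:R]/(p%:~R) => /eqP; rewrite eqr_int => /eqP.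
have e1 : econj w * y' - 1 = w * c1'.
  by apply: finj; rewrite rmorphB !rmorphM rmorph1.
have e2 : econj w - x' ^+ 3 = w * c2'.
  by apply: finj; rewrite rmorphB rmorphXn !rmorphM.
have [g gw] := eis_reduction pp wN.
have gw0 : g w = 0 by apply/gw; exists 1; rewrite mul1r.
have g1 : g (econj w) * g y' = 1.
  by apply/eqP; rewrite -subr_eq0 -rmorphM -(rmorph1 g) -rmorphB e1 rmorphM /= gw0 mul0r.
have g2 : g (econj w) = g x' ^+ 3.
  by apply/eqP; rewrite -subr_eq0 -rmorphXn -rmorphB e2 rmorphM /= gw0 mul0r.
(* The cube root is nonzero because [econj w] is invertible modulo [w]. *)
exists w; split=> //; exists (g x').
  apply/eqP => gx; move: g1; rewrite g2 gx expr0n mul0r => /esym/eqP.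
  by rewrite oner_eq0.
rewrite -g2 -[RHS]add0r -gw0 -rmorphD.
by rewrite add_econj rmorph_int.
Qed.

Theorem theorem2p2 (R : realType) (u v : R[i])
    (hu : u ^+ 2 + u + 1 = 0) (hv : v ^+ 2 + v + 1 = 0) (huv : u <> v) :
  (forall p : nat, prime p ->
     (p = 4 %[mod 9])%N \/ (p = 7 %[mod 9])%N ->
     conditionI u v p ->
     ~ sum_two_cubes u v (u * p%:R) /\ ~ sum_two_cubes u v (u * p%:R ^+ 2))
  /\
  (forall p : nat, prime p -> (p <= 73)%N ->
     (p = 4 %[mod 9])%N \/ (p = 7 %[mod 9])%N ->
     ~ sum_two_cubes u v (u * p%:R) /\ ~ sum_two_cubes u v (u * p%:R ^+ 2)).
Proof.
have vE := root_sum hu hv huv.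
have main p : (exists w, good_factor p w) ->
    ~ sum_two_cubes u v (u * p%:R) /\ ~ sum_two_cubes u v (u * p%:R ^+ 2).
  move=> [w gw]; split; last exact: not_sum_two_cubes gw _.
  by rewrite -[p%:R]expr1; apply: not_sum_two_cubes gw _.
split=> p pp h p47; apply: main; last exact: good_factor_small.
exact: conditionI_good p47.
Qed.
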